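(* Let $N,M\ge1$, $\lambda_1,\dots,\lambda_N>0$, $\lambda_C=\sum_{i=1}^N\lambda_i$, and let $b_1,\dots,b_N\ge0$ be not all zero. For $\mathbf{P_C}=(p^c_{ij})\in[0,1]^{N\times M}$ put $\tilde p_j=\frac1{\lambda_C}\sum_{i=1}^N\lambda_ip^c_{ij}$ for $j=1,\dots,M$, and consider the problem of minimizing $$f(\mathbf{P_C})=\sum_{j=1}^M\frac1{\tilde p_j}$$ over all $\mathbf{P_C}\in[0,1]^{N\times M}$ satisfying the linear constraints $\sum_{j=1}^Mp^c_{ij}\le b_i$ for $i=1,\dots,N$. Then every feasible $\mathbf{P_C}$ such that $\sum_{j=1}^Mp^c_{ij}=\min(M,b_i)$ for all $i$ and $\tilde p_1=\dots=\tilde p_M$ is a global minimizer. In particular, the equal distribution $$p^{c*}_{ij}=\frac{\min(M,b_i)}{M},\qquad i=1,\dots,N,\ j=1,\dots,M,$$ is a global minimizer.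
   Context: Convention: $1/0=+\infty$, so $f(\mathbf{P_C})=+\infty$ if some $\tilde p_j=0$. *)

(* Defs.v *)
From HB Require Import structures.
From mathcomp Require Import all_boot all_order all_algebra.
From mathcomp Require Import reals constructive_ereal.

Set Implicit Arguments.
Unset Strict Implicit.
Unset Printing Implicit Defensive.

Import Order.TTheory GRing.Theory Num.Theory.
Local Open Scope ring_scope.

Definition lambdaC (R : realType) (N : nat) (lam : 'I_N -> R) : R :=
  \sum_(i < N) lam i.

Definition ptilde (R : realType) (N M : nat) (lam : 'I_N -> R)
    (P : 'M[R]_(N, M)) (j : 'I_M) : R :=
  1 / lambdaC lam * \sum_(i < N) lam i * P i j.

(* The inverse is the one of extended reals, for which [0^-1 = +oo], whereas
   the inverse of the field [R] satisfies [0^-1 = 0]. *)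
Definition objective (R : realType) (N M : nat) (lam : 'I_N -> R)
    (P : 'M[R]_(N, M)) : \bar R :=
  (\sum_(j < M) 1 / (ptilde lam P j)%:E)%E.

Definition feasible (R : realType) (N M : nat) (b : 'I_N -> R)
    (P : 'M[R]_(N, M)) : Prop :=
  (forall i j, 0 <= P i j <= 1) /\
  (forall i, \sum_(j < M) P i j <= b i).

Definition global_minimizer (R : realType) (N M : nat) (lam b : 'I_N -> R)
    (P : 'M[R]_(N, M)) : Prop :=
  feasible b P /\
  forall Q : 'M[R]_(N, M), feasible b Q ->
    (objective lam P <= objective lam Q)%E.

Definition equal_distribution (R : realType) (N M : nat) (b : 'I_N -> R) :
    'M[R]_(N, M) :=
  \matrix_(i < N, j < M) (Num.min M%:R (b i) / M%:R).

(* Main.v *)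
Require Import Defs.
From HB Require Import structures.
From mathcomp Require Import all_boot all_order all_algebra.
From mathcomp Require Import reals constructive_ereal.
From mathcomp Require Import ring.

Set Implicit Arguments.
Unset Strict Implicit.
Unset Printing Implicit Defensive.

Import Order.TTheory GRing.Theory Num.Theory.
Local Open Scope ring_scope.

(** The map [x |-> 1 / x] lies above its tangent at the common value [t] of the
    [ptilde lam P j]. Summing over [j], the linear terms only involve
    [\sum_j ptilde lam Q j], which is at most [M * t] because row [i] of a
    feasible [Q] has sum at most [min(M, b i)]. *)

Lemma tangent_le_inve (R : realType) (t s : R) : 0 < t -> 0 <= s ->
  ((2 / t - s / t ^+ 2)%:E <= 1 / s%:E)%E.
Proof.
move=> t0; rewrite le_eqVlt => /predU1P[<-|s0].
  (* For [s = 0] the right-hand side is [+oo], the inverse of zero in the extended reals. *)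
  by rewrite inve0 mul1e leey.
rewrite inver gt_eqF// mul1e lee_fin -subr_ge0.
(* The gap between the curve and its tangent at [t] is a square over a positive denominator. *)
have -> : s^-1 - (2 / t - s / t ^+ 2) = (s - t) ^+ 2 / (s * t ^+ 2).
  by field; rewrite !gt_eqF.
by rewrite divr_ge0 ?sqr_ge0// mulr_ge0 ?sqr_ge0// ltW.
Qed.

(** The index [i0] witnesses that the sum is not empty. *)
Lemma lambdaC_gt0 (R : realType) (N : nat) (lam : 'I_N -> R) (i0 : 'I_N) :
  (forall i, 0 < lam i) -> 0 < lambdaC lam.
Proof.
move=> hlam; rewrite /lambdaC (bigD1 i0)//= ltr_pwDl//.
by apply: sumr_ge0 => i _; rewrite ltW.
Qed.

(** Exchanging the two sums shows that the total depends on [P] only through its row sums, which are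
    what the constraints control. *)
Lemma sum_ptilde (R : realType) (N M : nat) (lam : 'I_N -> R)
    (P : 'M[R]_(N, M)) :
  \sum_(j < M) ptilde lam P j =
  1 / lambdaC lam * \sum_(i < N) lam i * \sum_(j < M) P i j.
Proof.
rewrite /ptilde -mulr_sumr exchange_big; congr (_ * _).
by apply: eq_bigr => i _; rewrite mulr_sumr.
Qed.

(** The bound [M] comes from the [M] entries of the row being at most 1, the bound [b i] from the
    linear constraint. *)
Lemma feasible_row_sum_le (R : realType) (N M : nat) (b : 'I_N -> R)
    (P : 'M[R]_(N, M)) (i : 'I_N) :
  feasible b P -> \sum_(j < M) P i j <= Num.min M%:R (b i).
Proof.
case=> hP hPb; rewrite le_min hPb andbT -[leRHS]mulr1 mulr_natl.
rewrite -[X in _ *+ X]card_ord -sumr_const.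
by apply: ler_sum => j _; case/andP: (hP i j).
Qed.

Section MinimizerCriterion.
Variables (R : realType) (N M : nat) (lam b : 'I_N -> R).
Hypotheses (hM : (0 < M)%N) (hlam : forall i, 0 < lam i).
Hypotheses (hb : forall i, 0 <= b i) (hb0 : exists i, b i != 0).

Lemma equal_ptilde_global_minimizer (P : 'M[R]_(N, M)) :
  feasible b P ->
  (forall i, \sum_(j < M) P i j = Num.min M%:R (b i)) ->
  (forall j k, ptilde lam P j = ptilde lam P k) ->
  global_minimizer lam b P.
Proof.
move=> fP rowP eqP; split=> // Q fQ.
have [i0 bi0] := hb0.
have lamC0 : 0 < lambdaC lam by exact: lambdaC_gt0.
pose t := ptilde lam P (Ordinal hM).
have ptE j : ptilde lam P j = t by exact: eqP.
have sumP : \sum_(j < M) ptilde lam P j = M%:R * t.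
  by rewrite (eq_bigr _ (fun j _ => ptE j)) sumr_const card_ord mulr_natl.
have M0 : 0 < M%:R :> R by rewrite ltr0n.
(* The tangent at [t] requires [t] to be positive. As [M * t] is a positive multiple of the weighted
   total of the row sums, it suffices that row [i0], where [b i0] is nonzero, contributes a positive
   term. *)
have t0 : 0 < t.
  rewrite -(pmulr_rgt0 _ M0) -sumP sum_ptilde mulr_gt0 ?divr_gt0//.
  have minb i : 0 <= Num.min M%:R (b i) by rewrite le_min hb ltW.
  rewrite (bigD1 i0)//= ltr_pwDl//.
    by rewrite rowP mulr_gt0// lt_min M0 lt_neqAle eq_sym bi0 hb.
  by apply: sumr_ge0 => i _; rewrite rowP mulr_ge0// ltW.
have sumQ : \sum_(j < M) ptilde lam Q j <= M%:R * t.
  rewrite -sumP !sum_ptilde ler_pM2l ?divr_gt0//.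
  by apply: ler_sum => i _; rewrite ler_pM2l// rowP feasible_row_sum_le.
have ptQ0 j : 0 <= ptilde lam Q j.
  apply: mulr_ge0; first by rewrite divr_ge0// ltW.
  apply: sumr_ge0 => i _; apply: mulr_ge0; first exact: ltW.
  by case: fQ => /(_ i j)/andP[].
(* The sum of the tangent values at the [ptilde lam Q j] separates the two objectives. *)
apply: (@le_trans _ _ (\sum_(j < M) (2 / t - ptilde lam Q j / t ^+ 2)%:E)%E);
  last by apply: lee_sum => j _; exact: tangent_le_inve.
have -> : objective lam P = (M%:R / t)%:E.
  rewrite /objective (eq_bigr (fun=> (t^-1)%:E)) => [|j _].
    by rewrite sumEFin sumr_const card_ord mulr_natl.
  by rewrite ptE inver gt_eqF// mul1e.
rewrite sumEFin lee_fin sumrB sumr_const card_ord -mulr_suml -[2 / t *+ M]mulr_natl.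
(* This writes the objective of [P] as the tangent sum for a total of exactly [M * t], so that only
   [sumQ] remains to be used. *)
have -> : M%:R / t = M%:R * (2 / t) - M%:R * t / t ^+ 2.
  by field; rewrite gt_eqF.
by rewrite lerD2l lerN2 ler_pM2r// invr_gt0 exprn_gt0.
Qed.

Lemma equal_distribution_row_sum (i : 'I_N) :
  \sum_(j < M) equal_distribution M b i j = Num.min M%:R (b i).
Proof.
rewrite (eq_bigr (fun=> Num.min M%:R (b i) / M%:R)); last by move=> j; rewrite mxE.
by rewrite sumr_const card_ord -[LHS]mulr_natr divfK// pnatr_eq0 -lt0n.
Qed.

Lemma equal_distribution_feasible : feasible b (equal_distribution M b).
Proof.
have M0 : 0 < M%:R :> R by rewrite ltr0n.
split=> [i j|i]; last by rewrite equal_distribution_row_sum ge_min lexx orbT.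
rewrite mxE divr_ge0 ?ler0n//=; last by rewrite le_min hb ler0n.
(* Capping [b i] at [M] is what keeps the entries at most 1. *)
by rewrite ler_pdivrMr// mul1r ge_min lexx.
Qed.

Lemma ptilde_equal_distribution (j k : 'I_M) :
  ptilde lam (equal_distribution M b) j = ptilde lam (equal_distribution M b) k.
Proof. by congr (_ * _); apply: eq_bigr => i _; rewrite !mxE. Qed.

End MinimizerCriterion.

Theorem mainTheorem3 (R : realType) (N M : nat) (hN : (1 <= N)%N)
    (hM : (1 <= M)%N) (lam b : 'I_N -> R)
    (hlam : forall i, 0 < lam i)
    (hb : forall i, 0 <= b i)
    (hb0 : exists i, b i != 0) :
  (forall P : 'M[R]_(N, M),
      feasible b P ->
      (forall i, \sum_(j < M) P i j = Num.min M%:R (b i)) ->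
      (forall j k, ptilde lam P j = ptilde lam P k) ->
      global_minimizer lam b P) /\
  global_minimizer lam b (equal_distribution M b).
Proof.
split=> [P|]; first exact: equal_ptilde_global_minimizer.
apply: equal_ptilde_global_minimizer => //.
- exact: equal_distribution_feasible.
- exact: equal_distribution_row_sum.
- exact: ptilde_equal_distribution.
Qed.
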